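(* Let $r,h,l$ be integers with $l\ge r>h\ge1$, and let $F$ be a graph in $\mathcal{F}_{r,h,l}$. Then (i) $\delta(F)=r$; (ii) $\kappa'(F)=h$; (iii) $\lambda_{h+1}(F)=\cdots=\lambda_l(F)=\rho(r,h)$; (iv) let $b$ be the largest odd integer with $b<l/h$, and let $g$ and $f$ be integer-valued functions on $V(F)$ such that $g(v)\le f(v)$ and $g(v)\equiv f(v)\pmod 2$ for each $v\in V(F)$, $f(w)=b$ for each $w\in U(F)$, and $f(V(C))=\sum_{v\in V(C)}f(v)\equiv1\pmod2$ for each component $C$ of $F-U(F)$. Then $F$ has no $(g,f)$-parity factor. In particular, $F$ has no odd $[1,b]$-factor whenever $r$ is even or $h$ is odd.
   Context: Graphs are finite and simple unless stated. $\delta$ is minimum degree, $\Delta$ maximum degree, $\kappa'$ edge-connectivity, $\lambda_i(F)$ the $i$-th largest adjacency eigenvalue. A $(g,f)$-parity factor (for $g\le f$, $g\equiv f \pmod 2$ pointwise) is a spanning subgraph $H$ with $g(v)\le d_H(v)\le f(v)$ and $d_H(v)\equiv f(v)\pmod2$ for all $v$; for odd integers $a\le b$, an odd $[a,b]$-factor is a $(g,f)$-parity factor with $g\equiv a$, $f\equiv b$. Notation: $\overline{G}$ is the complement, $mG$ the disjoint union of $m$ copies, and $G_1\vee\cdots\vee G_t$ is obtained from the disjoint union by adding all edges between $G_i$ and $G_{i+1}$ for each $i<t$. For positive integers $r>\eta$: $H(r,\eta)=\overline{\lfloor\eta/2\rfloor K_2}\vee K_{r+1-2\lfloor\eta/2\rfloor}$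 if at least one of $r,\eta$ is even; $H(r,\eta)=\overline{C_\eta}\vee\overline{\tfrac{r+2-\eta}{2}K_2}$ if both are odd with $\eta\ge3$; $H(r,1)=K_1\vee\overline{\tfrac{r-1}{2}K_2}\vee K_2$ if $r$ is odd. $\rho(r,\eta)=\frac12(r-2+\sqrt{(r+2)^2-8\lfloor\eta/2\rfloor})$ if at least one of $r,\eta$ is even; $\rho(r,\eta)=\frac12(r-3+\sqrt{(r+3)^2-4\eta})$ if both are odd with $\eta\ge3$; $\rho(r,1)$ is the largest real root of $x^3-(r-2)x^2-2rx+r-1=0$ if $r$ is odd. Splicing: let $B$ be a graph with $\Delta(B)=a$ and $\sum_{v\in V(B)}(a-d_B(v))=b$. If $u$ is a vertex of degree $b$ or $b+1$ in a graph $H$, splicing $B$ into $u$ means deleting $u$ and replacing each edge $uw$ of $H$ by an edge from $w$ to a vertex of $B$, distributed so that every vertex of $B$ now has degree $a$, except possibly one vertex which has degree $a+1$. $\mathcal{F}_{r,h,l}$ (for $l\ge r>h\ge1$) is the set of graphs obtained from the complete bipartite graph $K_{h,l}$ by splicing a copy of $H(r,h)$ into each of the $l$ vertices of degree $h$. For $F\in\mathcal{F}_{r,h,l}$, $U(F)$ is the set of $h$ vertices of $F$ corresponding to the vertices of degree $l$ in $K_{h,l}$. *)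

(* Defs.v *)
From HB Require Import structures.
From mathcomp Require Import all_boot all_order all_algebra.
From mathcomp Require Import polyrcf.

Set Implicit Arguments.
Unset Strict Implicit.
Unset Printing Implicit Defensive.

Import Order.TTheory GRing.Theory Num.Theory.

Record sgraph := SGraph {
  vertex :> finType;
  adj : rel vertex;
  adj_sym : symmetric adj;
  adj_irr : irreflexive adj }.

Section Invariants.
Variable G : sgraph.

Definition gdeg (v : G) : nat := #|[set w | adj v w]|.

(* Degrees are < #|G|, so the default value only matters for the null graph. *)
Definition min_degree : nat := \big[minn/#|G|]_(v : G) gdeg v.

Definition max_degree : nat := \max_(v : G) gdeg v.

Definition edges : {set {set G}} :=
  [set [set p.1; p.2] | p in [set p : G * G | adj p.1 p.2]].

Definition del_edges (X : {set {set G}}) : rel G :=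
  [rel x y | adj x y && ([set x; y] \notin X)].

Definition disconnecting (X : {set {set G}}) : bool :=
  (X \subset edges) &&
  [exists x : G, exists y : G, ~~ connect (del_edges X) x y].

(* When G has at least two vertices, deleting all edges disconnects it, so the
   default value is itself one of the minimised terms. *)
Definition edge_connectivity : nat :=
  \big[minn/#|edges|]_(X : {set {set G}} | disconnecting X) #|X|.

Definition del_verts (U : {set G}) : rel G :=
  [rel x y | [&& x \notin U, y \notin U & adj x y]].

(* The vertex sets of the components of G - U. *)
Definition components_del (U : {set G}) : {set {set G}} :=
  equivalence_partition (connect (del_verts U)) (~: U).

(* The relation H is the adjacency relation of a spanning subgraph. *)
Definition parity_factor (g f : G -> int) (H : rel G) : Prop :=
  [/\ symmetric H,
      subrel H (@adj G) &
      forall v : G,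
        let d := Posz #|[set w | H v w]| in
        (g v <= d <= f v)%R /\ (d = f v %[mod 2])%Z].

Definition has_parity_factor (g f : G -> int) : Prop :=
  exists H : rel G, parity_factor g f H.

Definition has_odd_factor (a b : int) : Prop :=
  has_parity_factor (fun=> a) (fun=> b).

End Invariants.

Section Spectrum.
Variable R : rcfType.
Local Open Scope ring_scope.

(* All roots of p in R, with multiplicity, in nonincreasing order. *)
Definition roots_desc (p : {poly R}) : seq R :=
  flatten [seq nseq (mup x p) x | x <- rev (rootsR p)].

Definition adj_mx (G : sgraph) : 'M[R]_#|G| :=
  \matrix_(i, j) (adj (enum_val i) (enum_val j))%:R.

(* The i-th largest adjacency eigenvalue, counted from i = 1. *)
Definition lambda (G : sgraph) (i : nat) : R :=
  (roots_desc (char_poly (adj_mx G)))`_i.-1.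

Definition rho (r eta : nat) : R :=
  if ~~ odd r || ~~ odd eta then
    (r%:R - 2 + Num.sqrt ((r%:R + 2) ^+ 2 - 8 * (eta./2)%:R)) / 2
  else if eta == 1%N then
    (roots_desc ('X^3 - (r%:R - 2) *: 'X^2 - (2 * r%:R) *: 'X + (r%:R - 1)%:P))`_0
  else
    (r%:R - 3 + Num.sqrt ((r%:R + 3) ^+ 2 - 4 * eta%:R)) / 2.

End Spectrum.

Section Complete.
Variable n : nat.
Definition complete_adj : rel 'I_n := [rel x y | x != y].
Lemma complete_sym : symmetric complete_adj.
Proof. by move=> x y; rewrite /complete_adj /= eq_sym. Qed.
Lemma complete_irr : irreflexive complete_adj.
Proof. by move=> x; rewrite /complete_adj /= eqxx. Qed.
Definition Kgraph : sgraph := SGraph complete_sym complete_irr.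
End Complete.

Section Cycle.
Variable n : nat.
Definition cycle_adj : rel 'I_n :=
  [rel x y : 'I_n | (x != y) &&
     ((y == x.+1 %% n :> nat) || (x == y.+1 %% n :> nat))].
Lemma cycle_sym : symmetric cycle_adj.
Proof. by move=> x y; rewrite /cycle_adj /= eq_sym orbC. Qed.
Lemma cycle_irr : irreflexive cycle_adj.
Proof. by move=> x; rewrite /cycle_adj /= eqxx. Qed.
Definition cycle_graph : sgraph := SGraph cycle_sym cycle_irr.
End Cycle.

Section Bipartite.
Variables h l : nat.
Definition bip_adj : rel ('I_h + 'I_l) := fun x y =>
  match x, y with
  | inl _, inr _ | inr _, inl _ => true
  | _, _ => false
  end.
Lemma bip_sym : symmetric bip_adj.
Proof. by case=> ? []. Qed.
Lemma bip_irr : irreflexive bip_adj.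
Proof. by case. Qed.
Definition complete_bip : sgraph := SGraph bip_sym bip_irr.
(* The l vertices of degree h. *)
Definition bip_right : {set complete_bip} :=
  [set x : complete_bip | if x is inr _ then true else false].
End Bipartite.

Section Complement.
Variable G : sgraph.
Definition compl_adj : rel G := [rel x y | (x != y) && ~~ adj x y].
Lemma compl_sym : symmetric compl_adj.
Proof. by move=> x y; rewrite /compl_adj /= eq_sym adj_sym. Qed.
Lemma compl_irr : irreflexive compl_adj.
Proof. by move=> x; rewrite /compl_adj /= eqxx. Qed.
Definition gcompl : sgraph := SGraph compl_sym compl_irr.
End Complement.

Section Copies.
Variables (m : nat) (G : sgraph).
Definition copies_adj : rel ('I_m * G) :=
  [rel x y | (x.1 == y.1) && adj x.2 y.2].
Lemma copies_sym : symmetric copies_adj.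
Proof. by move=> x y; rewrite /copies_adj /= eq_sym adj_sym. Qed.
Lemma copies_irr : irreflexive copies_adj.
Proof. by move=> x; rewrite /copies_adj /= adj_irr andbF. Qed.
Definition copies : sgraph := SGraph copies_sym copies_irr.
End Copies.

Section Join.
Variables G1 G2 : sgraph.
Definition join_adj : rel (G1 + G2) := fun x y =>
  match x, y with
  | inl a, inl b => adj a b
  | inr a, inr b => adj a b
  | _, _ => true
  end.
Lemma join_sym : symmetric join_adj.
Proof. by case=> x [] y //=; rewrite adj_sym. Qed.
Lemma join_irr : irreflexive join_adj.
Proof. by case=> x /=; rewrite adj_irr. Qed.
Definition gjoin : sgraph := SGraph join_sym join_irr.
End Join.

(* G1 \/ G2 \/ G3 has no edges between G1 and G3, so it is not an iterated
   binary join. *)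
Section Join3.
Variables G1 G2 G3 : sgraph.
Definition join3_adj : rel (G1 + G2 + G3) := fun x y =>
  match x, y with
  | inl (inl a), inl (inl b) => adj a b
  | inl (inr a), inl (inr b) => adj a b
  | inr a, inr b => adj a b
  | inl (inl _), inr _ | inr _, inl (inl _) => false
  | _, _ => true
  end.
Lemma join3_sym : symmetric join3_adj.
Proof. by move=> [[x|x]|x] [[y|y]|y] //=; rewrite adj_sym. Qed.
Lemma join3_irr : irreflexive join3_adj.
Proof. by move=> [[x|x]|x] /=; rewrite adj_irr. Qed.
Definition gjoin3 : sgraph := SGraph join3_sym join3_irr.
End Join3.

Definition Hgraph (r eta : nat) : sgraph :=
  if ~~ odd r || ~~ odd eta then
    gjoin (gcompl (copies eta./2 (Kgraph 2)))
          (Kgraph (r + 1 - 2 * eta./2))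
  else if eta == 1 then
    gjoin3 (Kgraph 1) (gcompl (copies (r - 1)./2 (Kgraph 2))) (Kgraph 2)
  else
    gjoin (gcompl (cycle_graph eta))
          (gcompl (copies (r + 2 - eta)./2 (Kgraph 2))).

(* Simultaneous splicing of a copy of B into every vertex of S.  The edge uw,
   with u in S, is moved at its u-end to the vertex phi u w of the copy of B
   replacing u (and likewise at its w-end when w is also in S). *)
Section Splice.
Variables (G : sgraph) (S : {set G}) (B : sgraph) (phi : G -> G -> B).

Definition splice_vertex : finType :=
  ({x : G | x \notin S} + {x : G | x \in S} * B)%type.

Definition splice_adj : rel splice_vertex := fun x y =>
  match x, y with
  | inl w, inl w' => adj (val w) (val w')
  | inl w, inr (u, v) => adj (val w) (val u) && (phi (val u) (val w) == v)
  | inr (u, v), inl w => adj (val w) (val u) && (phi (val u) (val w) == v)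
  | inr (u, v), inr (u', v') =>
      (u == u') && adj v v' ||
      [&& adj (val u) (val u'), phi (val u) (val u') == v
        & phi (val u') (val u) == v']
  end.

Lemma splice_sym : symmetric splice_adj.
Proof.
move=> [w|[u v]] [w'|[u' v']] //=; first by rewrite adj_sym.
rewrite eq_sym [adj v v']adj_sym [adj (val u) _]adj_sym.
by congr (_ || (_ && _)); rewrite andbC.
Qed.

Lemma splice_irr : irreflexive splice_adj.
Proof. by move=> [w|[u v]] /=; rewrite !adj_irr ?andbF. Qed.

Definition splice : sgraph := SGraph splice_sym splice_irr.

Definition splice_kept : {set splice} :=
  [set x : splice | if x is inl _ then true else false].

Definition valid_splicing : Prop :=
  let a := max_degree B in
  let b := \sum_(v : B) (a - gdeg v) in
  forall u : {x : G | x \in S},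
    (gdeg (val u) = b \/ gdeg (val u) = b + 1) /\
    exists v0 : B,
      let d (v : B) := gdeg (inr (u, v) : splice) in
      (d v0 = a \/ d v0 = a + 1) /\ (forall v, v != v0 -> d v = a).

End Splice.

(* F belongs to F_{r,h,l}, as witnessed by an isomorphism under which U is the
   set U(F) of the h vertices coming from the vertices of degree l of K_{h,l}. *)
Definition in_family (r h l : nat) (F : sgraph) (U : {set F}) : Prop :=
  exists phi : complete_bip h l -> complete_bip h l -> Hgraph r h,
    valid_splicing (bip_right h l) phi /\
    exists iso : splice (bip_right h l) phi -> F,
      [/\ bijective iso,
          (forall x y, adj (iso x) (iso y) = adj x y) &
          U = iso @: splice_kept (bip_right h l) phi].

Definition odd_int (b : int) : Prop := (b = 1 %[mod 2])%Z.

Definition largest_odd_below (q : rat) (b : int) : Prop :=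
  [/\ odd_int b, (b%:~R < q)%R &
      forall b' : int, odd_int b' -> (b'%:~R < q)%R -> (b' <= b)%R].

(* Main.v *)
Require Import Defs.
From HB Require Import structures.
From mathcomp Require Import all_boot all_order all_algebra.
From mathcomp Require Import polyrcf complex spectral zify ring lra.

Set Implicit Arguments.
Unset Strict Implicit.
Unset Printing Implicit Defensive.

Import Order.TTheory GRing.Theory Num.Theory.

(** A member F of the family consists of the h vertices of U(F) and of l copies
    of the block B = H(r,h), each vertex of U(F) sending one edge to each copy.

    (ii) Adjacent vertices x, y of B have at least d(x) + d(y) - |B| common
    neighbours, so for h >= 2 deleting fewer than h edges never disconnects a
    copy; each copy keeps an edge to U(F), and one copy keeps all of them.

    (iii) B has a positive eigenvector x for rho(r,h), constant on the parts of
    its join decomposition.  By AM-GM with weights given by x, the quadratic form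
    of B is at most rho(r,h) |z|^2.  The form of F therefore equals rho(r,h) |z|^2
    on the l-dimensional span of the copies of x, and is at most rho(r,h) |z|^2 on
    the subspace of codimension h vanishing on U(F); Courant-Fischer gives
    lambda_(h+1) <= rho(r,h) <= lambda_l.

    (iv) In a parity factor an odd number of edges, hence at least one, leaves
    each of the l components of F - U(F), while U(F) absorbs at most b h < l. *)

(** * Eigenvalues as sorted roots *)

Section RootsDesc.
Variable R : rcfType.
Local Open Scope ring_scope.

Lemma mup_prod_XsubC (s : seq R) (x : R) :
  mup x (\prod_(z <- s) ('X - z%:P)) = count_mem x s.
Proof.
elim: s => [|z s IHs]; first by rewrite big_nil mupNroot // rootE hornerE oner_eq0.
rewrite big_cons mupM ?polyXsubC_eq0 ?(monic_neq0 (monic_prod_XsubC _ _ _)) // IHs /=.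
by rewrite -[X in mup x X]expr1 mup_XsubCX eq_sym; case: eqP.
Qed.

Lemma mem_rootsR (p : {poly R}) x : p != 0 -> (x \in rootsR p) = root p x.
Proof. by move=> p0; rewrite -roots_on_rootsR // inE. Qed.

Lemma count_roots_desc (p : {poly R}) (x : R) :
  p != 0 -> count_mem x (roots_desc p) = mup x p.
Proof.
move=> p0; rewrite /roots_desc count_flatten -map_comp.
rewrite (eq_map (_ : _ =1 (fun y => (y == x) * mup y p)%N)); last first.
  by move=> y /=; rewrite count_nseq.
rewrite sumnE big_map; under eq_bigr do rewrite mulnbl.
rewrite -big_mkcond -big_filter.
have -> : [seq y <- rev (rootsR p) | y == x] = if root p x then [:: x] else [::].
  case: ifP => rx.
    by rewrite filter_pred1_uniq ?rev_uniq ?uniq_roots // mem_rev mem_rootsR.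
  apply/eqP; rewrite -(negbK (_ == _)) -has_filter has_pred1.
  by rewrite mem_rev mem_rootsR // rx.
case: ifP => [_|/negbT rx]; first by rewrite big_seq1.
by rewrite big_nil mupNroot.
Qed.

Lemma roots_desc_sorted (p : {poly R}) : sorted >=%R (roots_desc p).
Proof.
rewrite /roots_desc.
have : sorted >%R (rev (rootsR p)) by rewrite rev_sorted; apply: sorted_roots.
elim: (rev _) => //= x s IHs xs.
have /IHs {}IHs := path_sorted xs.
rewrite (sorted_pairwise ge_trans) pairwise_cat -!(sorted_pairwise ge_trans) IHs andbT.
apply/andP; split.
  apply/allrelP => y z; rewrite mem_nseq => /andP[_ /eqP->] /flatten_mapP[t ts].
  rewrite mem_nseq => /andP[_ /eqP->].
  by move: xs; rewrite (path_sortedE (rev_trans lt_trans)) => /andP[/allP/(_ _ ts)/ltW].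
by elim: (mup x p) => //= -[|k] //= ->; rewrite lexx.
Qed.

Lemma perm_roots_desc (p : {poly R}) (s : seq R) :
  p = \prod_(z <- s) ('X - z%:P) -> perm_eq (roots_desc p) s.
Proof.
move=> ps; apply/allP => x _ /=; apply/eqP.
by rewrite count_roots_desc ps ?(monic_neq0 (monic_prod_XsubC _ _ _)) // mup_prod_XsubC.
Qed.

(** If entry [i] is below [a], so are all later ones, and at most [i] entries reach [a]. *)
Lemma sorted_nth_ge (s : seq R) (a : R) i :
  sorted >=%R s -> (i < count (>= a) s)%N -> a <= s`_i.
Proof.
move=> ss; apply: contraTT; rewrite -ltNge -leqNgt => ai.
have [si|si] := leqP (size s) i; first exact: leq_trans (count_size _ _) si.
rewrite -(cat_take_drop i s) count_cat.
rewrite [X in (_ + X)%N](_ : _ = 0%N) ?addn0.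
  by rewrite (leq_trans (count_size _ _)) // size_take si.
apply/eqP; rewrite -leqn0 leqNgt -has_count; apply/hasPn => x /(nthP 0)[j].
rewrite size_drop => js <-; rewrite nth_drop /= -ltNge; apply: le_lt_trans ai.
apply: (sorted_leq_nth ge_trans (@lexx _ R) 0 ss); rewrite ?inE ?leq_addr //.
by rewrite -ltn_subRL.
Qed.

(** If entry [i] exceeds [a], so do the first [i + 1] entries, which leaves at most [size s - i - 1]
    others. *)
Lemma sorted_nth_le (s : seq R) (a : R) i :
  sorted >=%R s -> (i < size s)%N -> (size s - i <= count (<= a) s)%N -> s`_i <= a.
Proof.
move=> ss si; apply: contraTT; rewrite -ltNge -ltnNge => ai.
rewrite -{1}(cat_take_drop i.+1 s) count_cat.
rewrite [X in (X + _)%N](_ : _ = 0%N) ?add0n.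
  by rewrite (leq_ltn_trans (count_size _ _)) // size_drop ltn_sub2l.
apply/eqP; rewrite -leqn0 leqNgt -has_count; apply/hasPn => x /(nthP 0)[j].
rewrite size_take => js <-.
have {}js : (j <= i)%N by rewrite -ltnS (leq_trans js) //; case: ltnP.
rewrite nth_take ?ltnS // /= -ltNge; apply: (lt_le_trans ai).
by apply: (sorted_leq_nth ge_trans (@lexx _ R) 0 ss); rewrite ?inE // (leq_ltn_trans js).
Qed.
End RootsDesc.

(** * Courant-Fischer bounds *)

Section Courant.
Variable R : rcfType.
Local Open Scope ring_scope.
Local Open Scope sesquilinear_scope.
Local Notation C := (R[i]).
Local Notation toC := (map_mx (real_complex R)).

Lemma char_poly_conj (K : fieldType) n (P A : 'M[K]_n) :
  P \in unitmx -> char_poly (invmx P *m A *m P) = char_poly A.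
Proof.
move=> Pu; rewrite /char_poly /char_poly_mx.
have PV : map_mx polyC (invmx P) *m map_mx polyC P = 1%:M.
  by rewrite -map_mxM mulVmx // map_mx1.
have -> : 'X%:M - map_mx polyC (invmx P *m A *m P) =
  map_mx polyC (invmx P) *m ('X%:M - map_mx polyC A) *m map_mx polyC P.
  rewrite mulmxBr mulmxBl !map_mxM; congr (_ - _).
  by rewrite scalar_mxC -mulmxA PV mulmx1.
by rewrite !det_mulmx mulrAC -det_mulmx PV det1 mul1r.
Qed.

Lemma real_symmetric_diag n (A : 'M[R]_n) : A^T = A ->
  exists (d : 'rV[R]_n) (P : 'M[C]_n),
    [/\ P \is unitarymx, toC A = P^t* *m diag_mx (toC d) *m P
      & char_poly A = \prod_(i < n) ('X - (d 0 i)%:P)].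
Proof.
move=> AT.
have Aher : toC A \is hermsymmx.
  apply: realsym_hermsym.
    by apply/is_hermitianmxP; rewrite expr0 scale1r map_mx_id // map_trmx AT.
  by apply/mxOverP => i j; rewrite mxE complex_real.
have /hermitian_normalmx/orthomx_spectralP := Aher.
have := hermitian_spectral_diag_real Aher.
have := spectral_unitarymx (toC A).
set P := spectralmx _; set D := spectral_diag _ => Pu /mxOverP Dr AE.
pose d : 'rV[R]_n := map_mx (@complex.Re R) D.
have DE : D = toC d by apply/rowP => i; rewrite !mxE RRe_real.
exists d, P; split=> //; first by rewrite -DE AE invmx_unitary.
apply: (map_inj_poly (@complexI R)) => //.
rewrite map_char_poly AE char_poly_conj ?unitarymx_unit //.
rewrite char_poly_trig ?diag_mx_is_trig // rmorph_prod.
by apply: eq_bigr => i _; rewrite mxE eqxx DE mxE rmorphB /= map_polyX map_polyC.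
Qed.

(** For [c = a + ib] the cross terms cancel by symmetry of [M], leaving the sum of the real forms at
    [a] and [b]. This serves because the eigenbasis is complex. *)
Lemma complex_form_ge0 n (M : 'M[R]_n) (c : 'rV[C]_n) : M^T = M ->
  (forall a : 'rV[R]_n, 0 <= (a *m M *m a^T) 0 0) ->
  0 <= (c *m toC M *m c^t*) 0 0.
Proof.
move=> MT M0.
pose a := map_mx (@complex.Re R) c; pose b := map_mx (@complex.Im R) c.
have cE : c = toC a + 'i%C *: toC b.
  by apply/rowP => i; rewrite !mxE [LHS]complexE.
have cTE : c^t* = toC a^T - 'i%C *: toC b^T.
  apply/colP => i; rewrite !mxE; case: (c 0 i) => u v.
  by apply/eqP; rewrite eq_complex /= !(mul0r,mul1r,mulr0,subr0,sub0r,oppr0,addr0,add0r) !eqxx.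
have bMa : b *m M *m a^T = a *m M *m b^T.
  have: (b *m M *m a^T)^T = a *m M *m b^T by rewrite !trmx_mul trmxK MT mulmxA.
  by move <-; apply/matrixP => i j; rewrite [RHS]mxE !ord1.
rewrite [X in fun_of_matrix X](_ : _ = toC (a *m M *m a^T + b *m M *m b^T)).
  by rewrite mxE ler0c mxE addr_ge0.
rewrite cTE {1}cE mulmxDl mulmxDl !mulmxBr -!scalemxAl -!scalemxAr -!map_mxM.
rewrite bMa scalerA -expr2 sqr_i scaleN1r opprK map_mxD.
by rewrite -!addrA; congr (_ + _); rewrite addKr.
Qed.

(** Courant-Fischer in counting form: with fewer than [k] eigenvalues [>= t], some nonzero vector in
    the complex span of [V] would be orthogonal to their eigenvectors, and the form of [A - t] would
    be negative there. *)
Lemma count_eigenvalues_ge n k (A : 'M[R]_n) (d : 'rV[R]_n) (P : 'M[C]_n)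
    (V : 'M[R]_(k, n)) (t : R) :
  A^T = A -> P \is unitarymx -> toC A = P^t* *m diag_mx (toC d) *m P ->
  row_free V ->
  (forall c : 'rV_k,
     t * (c *m V *m (c *m V)^T) 0 0 <= (c *m V *m A *m (c *m V)^T) 0 0) ->
  (k <= #|[set i | (t <= d 0 i)%R]|)%N.
Proof.
move=> AT Pu AE Vf VA; set E := [set i | _].
rewrite leqNgt; apply/negP => Ek.
pose f : 'I_#|E| -> 'I_n := enum_val.
(* [W] holds the eigencoordinates, at the indices in [E], of the rows of [V]. It has fewer columns
   than rows, hence a nonzero left kernel. *)
pose W := toC V *m P^t* *m (\matrix_(i < n, j < #|E|) (i == f j)%:R).
have /rowV0Pn[c /sub_kermxP cW c0] : kermx W != 0.
  rewrite kermx_eq0 /row_free neq_ltn.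
  by rewrite (leq_ltn_trans (rank_leq_col _)).
pose y := c *m toC V *m P^t*.
have yE i : t <= d 0 i -> y 0 i = 0.
  move=> ti; have iE : i \in E by rewrite inE.
  have /rowP/(_ (enum_rank_in iE i)) := cW; rewrite [RHS]mxE /W !mulmxA -/y mxE => <-.
  rewrite (bigD1 i) //= [X in _ * X]mxE /f enum_rankK_in // eqxx mulr1 big1 ?addr0 // => j ji.
  by rewrite [X in _ * X]mxE /f enum_rankK_in // (negPf ji) mulr0.
have Put : P^t* *m P = 1%:M by rewrite -invmx_unitary // mulVmx // unitarymx_unit.
have y0 : y != 0.
  apply: contraNneq c0 => y0; rewrite -(mulmx_free_eq0 _ (_ : row_free (toC V))) ?row_free_map //.
  by rewrite -[c *m _]mulmx1 -Put mulmxA -/y y0 mul0mx.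
pose M := V *m (A - t%:M) *m V^T.
have MT : M^T = M by rewrite /M !trmx_mul trmxK linearB /= AT tr_scalar_mx mulmxA.
have /(complex_form_ge0 c MT) : forall a : 'rV[R]_k, 0 <= (a *m M *m a^T) 0 0.
  move=> a; have := VA a; rewrite -subr_ge0; congr (_ <= _).
  rewrite /M trmx_mul !mulmxA mulmxBr !mulmxBl [RHS]mxE; congr (_ + _).
  by rewrite mul_mx_scalar -!scalemxAl [RHS]mxE [in RHS]mxE.
have AtE : toC (A - t%:M) = P^t* *m (diag_mx (toC d) - (t%:C)%C%:M) *m P.
  rewrite map_mxB map_scalar_mx /= AE mulmxBr mulmxBl; congr (_ - _).
  by rewrite scalar_mxC -mulmxA Put mulmx1.
have -> : c *m toC M *m c^t* = y *m (diag_mx (toC d) - (t%:C)%C%:M) *m y^t*.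
  have -> : y^t* = P *m (toC V^T) *m c^t*.
    rewrite /y !trmx_mul !map_mxM !trmxCK mulmxA; congr (_ *m _ *m _).
    by apply/matrixP => i j; rewrite !mxE; apply: conjc_real.
  by rewrite /M !map_mxM AtE /y !mulmxA.
rewrite mxE; apply/negP/negbT/lt_geF.
have [i0 yi0] : exists i, y 0 i != 0.
  apply/existsP; apply: contraNT y0 => /existsPn y0.
  by apply/eqP/rowP => i; rewrite [RHS]mxE; apply/eqP; rewrite -[_ == _]negbK.
(* In eigencoordinates the form is a weighted sum of squares, and [y] vanishes wherever the weight
   is nonnegative. *)
rewrite (eq_bigr (fun i => (d 0 i - t)%:C%C * `|y 0 i| ^+ 2)); last first.
  move=> i _; rewrite mxE (bigD1 i) //= big1 ?addr0 => [|j ji].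
    by rewrite !mxE eqxx !mulr1n normCK rmorphB /= mulrAC mulrC.
  by rewrite !mxE (negPf ji) !mulr0n subr0 mulr0.
have neg i : y 0 i != 0 -> (d 0 i - t)%:C%C * `|y 0 i| ^+ 2 < 0.
  move=> yi; rewrite pmulr_llt0 ?exprn_gt0 ?normr_gt0 // ltcE /= eqxx subr_lt0 ltNge.
  by apply: contraNN yi => /yE ->.
rewrite (bigD1 i0) //= -[ltRHS]addr0 ltr_leD ?neg // sumr_le0 // => i _.
by have [->|/neg/ltW//] := eqVneq (y 0 i) 0; rewrite normr0 expr0n mulr0.
Qed.

Lemma count_row n (d : 'rV[R]_n) (a : pred R) :
  count a [seq d 0 i | i : 'I_n] = #|[set i | a (d 0 i)]|.
Proof.
by rewrite -sum1_card -sum1_count big_image_cond; apply: eq_bigl => i; rewrite !inE.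
Qed.

Lemma eigenvalue_ge n k (A : 'M[R]_n) (V : 'M[R]_(k, n)) (t : R) (i : nat) :
  A^T = A -> row_free V ->
  (forall c : 'rV_k,
     t * (c *m V *m (c *m V)^T) 0 0 <= (c *m V *m A *m (c *m V)^T) 0 0) ->
  (i < k)%N -> t <= (roots_desc (char_poly A))`_i.
Proof.
move=> AT Vf VA ik; have [d [P [Pu AE cA]]] := real_symmetric_diag AT.
apply: sorted_nth_ge; first exact: roots_desc_sorted.
have /perm_roots_desc/permP-> : char_poly A = \prod_(z <- [seq d 0 i | i : 'I_n]) ('X - z%:P).
  by rewrite big_image.
by rewrite count_row (leq_trans ik) // (count_eigenvalues_ge AT Pu AE Vf VA).
Qed.

Lemma eigenvalue_le n k (A : 'M[R]_n) (V : 'M[R]_(k, n)) (t : R) (i : nat) :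
  A^T = A -> row_free V ->
  (forall c : 'rV_k,
     (c *m V *m A *m (c *m V)^T) 0 0 <= t * (c *m V *m (c *m V)^T) 0 0) ->
  (n - k <= i < n)%N -> (roots_desc (char_poly A))`_i <= t.
Proof.
move=> AT Vf VA /andP[ki ni]; have [d [P [Pu AE cA]]] := real_symmetric_diag AT.
have /perm_roots_desc pr : char_poly A = \prod_(z <- [seq d 0 i | i : 'I_n]) ('X - z%:P).
  by rewrite big_image.
have sz : size (roots_desc (char_poly A)) = n.
  by rewrite (perm_size pr) size_image card_ord.
apply: sorted_nth_le; rewrite ?sz //; first exact: roots_desc_sorted.
rewrite (permP pr) count_row leq_subCl (leq_trans _ ki) // leq_sub2l //.
(* The count for [- A] and [- t] is the number of eigenvalues of [A] that are at most [t]. *)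
have NAE : toC (- A) = P^t* *m diag_mx (toC (- d)) *m P.
  by rewrite map_mxN AE map_mxN (linearN (@diag_mx _ _)) mulmxN mulNmx.
have NAT : (- A)^T = - A by rewrite linearN /= AT.
rewrite (leq_trans (count_eigenvalues_ge (t := - t) NAT Pu NAE Vf _)) //.
  by move=> c; rewrite mulmxN mulNmx mulNr [leRHS]mxE lerN2.
by rewrite subset_leq_card //; apply/subsetP => j; rewrite !inE mxE lerN2.
Qed.
End Courant.

(** * Degrees, connectivity and Perron vectors of graphs *)

(** The default [d] enters the minimum as one more term, whence the condition on it. *)
Lemma bigminn_eq (I : finType) (P : pred I) (f : I -> nat) (d m : nat) :
  m <= d -> (forall i, P i -> m <= f i) -> (exists2 i, P i & f i = m) ->
  \big[minn/d]_(i | P i) f i = m.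
Proof.
move=> md mf [i Pi fi]; apply/eqP; rewrite eqn_leq; apply/andP; split; last first.
  by apply: (big_ind (leq m)) => // a b ma mb; rewrite leq_min ma.
rewrite -big_filter; have : i \in [seq j <- index_enum I | P j].
  by rewrite mem_filter Pi mem_index_enum.
elim: [seq _ <- _ | _] => //= j s IHs; rewrite inE big_cons geq_min.
by case/predU1P => [<-|/IHs ->]; rewrite ?fi ?leqnn // orbT.
Qed.

Section Degrees.
Implicit Types G : sgraph.

Lemma gdegE G (v : G) : gdeg v = \sum_w adj v w.
Proof. by rewrite /gdeg -sum1_card big_mkcond; apply: eq_bigr => w _; rewrite inE; case: adj. Qed.

Lemma max_degree_eq G (v : G) :
  (forall w : G, gdeg w <= gdeg v) -> max_degree G = gdeg v.
Proof.
move=> vmax; apply/eqP; rewrite eqn_leq; apply/andP; split.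
  by apply/bigmax_leqP => w _.
exact: (leq_bigmax v).
Qed.

Lemma gdeg_join_l (G1 G2 : sgraph) (a : G1) :
  gdeg (inl a : gjoin G1 G2) = gdeg a + #|G2|.
Proof. by rewrite !gdegE big_sumType /= sum1_card. Qed.

Lemma gdeg_join_r (G1 G2 : sgraph) (b : G2) :
  gdeg (inr b : gjoin G1 G2) = #|G1| + gdeg b.
Proof. by rewrite !gdegE big_sumType /= sum1_card. Qed.

Lemma gdeg_join3_l (G1 G2 G3 : sgraph) (a : G1) :
  gdeg (inl (inl a) : gjoin3 G1 G2 G3) = gdeg a + #|G2|.
Proof. by rewrite !gdegE !big_sumType /= sum1_card [X in _ + X]big1 ?addn0. Qed.

Lemma gdeg_join3_m (G1 G2 G3 : sgraph) (b : G2) :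
  gdeg (inl (inr b) : gjoin3 G1 G2 G3) = #|G1| + gdeg b + #|G3|.
Proof. by rewrite !gdegE !big_sumType /= !sum1_card. Qed.

Lemma gdeg_join3_r (G1 G2 G3 : sgraph) (c : G3) :
  gdeg (inr c : gjoin3 G1 G2 G3) = #|G2| + gdeg c.
Proof. by rewrite !gdegE !big_sumType /= sum1_card big1 ?add0n. Qed.

Lemma gdeg_compl G (v : G) : gdeg (v : gcompl G) + gdeg v + 1 = #|G|.
Proof.
rewrite !gdegE -big_split /= -sum1_card (bigD1 v) //= [in RHS](bigD1 v) //=.
rewrite /compl_adj /= eqxx adj_irr addnC; congr (_ + _); apply: eq_bigr => w /negPf wv.
by rewrite eq_sym wv /=; case: adj.
Qed.

Lemma gdeg_copies m G (x : copies m G) : gdeg x = gdeg x.2.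
Proof.
case: x => i v; rewrite !gdegE -(pair_bigA _ (fun j w => (((i == j) && adj v w) : nat))) /=.
rewrite (bigD1 i) //= [X in _ + X]big1 ?addn0 => [|j /negPf ji].
  by apply: eq_bigr => w _; rewrite eqxx.
by rewrite big1 // => w _; rewrite eq_sym ji.
Qed.

Lemma gdeg_complete n (v : Kgraph n) : gdeg v + 1 = n.
Proof.
rewrite gdegE -[in RHS](card_ord n) -sum1_card (bigD1 v) //= [in RHS](bigD1 v) //=.
rewrite /complete_adj /= eqxx addnC; congr (_ + _); apply: eq_bigr => w.
by rewrite eq_sym => ->.
Qed.

(** The neighbours are the successor and the predecessor modulo [n], distinct because [n > 2]. *)
Lemma gdeg_cycle n (v : cycle_graph n) : 2 < n -> gdeg v = 2.
Proof.
move=> n2; rewrite /gdeg.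
have vn := ltn_ord (v : 'I_n).
have mS k : k < n -> k.+1 %% n = if k.+1 == n then 0 else k.+1.
  by move=> kn; case: eqP => [->|]; rewrite ?modnn // => ne; rewrite modn_small //; lia.
have ltS : v.+1 %% n < n by rewrite ltn_mod; lia.
have ltP : (if (v : nat) == 0 then n.-1 else v.-1) < n by case: ifP; lia.
have -> : [set w | adj v w] = [set Ordinal ltS; Ordinal ltP].
  apply/setP => w; rewrite !inE /= /cycle_adj /= -!(inj_eq val_inj) /=.
  have wn := ltn_ord (w : 'I_n).
  by rewrite !mS //; case: (v.+1 =P n); case: (w.+1 =P n); case: (@eqP _ (v : nat) 0); lia.
rewrite cards2 -(inj_eq val_inj) /= mS //.
by case: (v.+1 =P n); case: ifP; lia.
Qed.

Lemma card_copies m G : #|copies m G| = m * #|G|.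
Proof. by rewrite card_prod card_ord. Qed.

Lemma card_join G1 G2 : #|gjoin G1 G2| = #|G1| + #|G2|.
Proof. exact: card_sum. Qed.

Lemma card_complete n : #|Kgraph n| = n.
Proof. exact: card_ord. Qed.

(** In the complement of a perfect matching a vertex misses only itself and its partner. *)
Lemma gdeg_cocktail m (v : gcompl (copies m (Kgraph 2))) : gdeg v + 2 = 2 * m.
Proof.
have := @gdeg_compl (copies m (Kgraph 2)) v; rewrite gdeg_copies card_copies.
by have := gdeg_complete (v.2 : Kgraph 2); rewrite card_complete; lia.
Qed.
End Degrees.

(** * Edge-connectivity from common neighbours *)

Section Connectivity.
Variable G : sgraph.
Implicit Types (X : {set {set G}}) (x y v : G).

(** [X] may be any family of vertex sets, not only of edges, so the preimage of an edge set under an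
    embedding can be used directly. *)
Definition edge_conn_ge (h : nat) : Prop :=
  forall X, #|X| < h -> forall x y, connect (del_edges X) x y.

Lemma connect_del_edges_sym X : connect_sym (del_edges X).
Proof. by apply: sym_connect_sym => x y; rewrite /del_edges /= adj_sym setUC. Qed.

(* The edge xy and the paths xwy through the common neighbours w are
   edge-disjoint, so each one that is destroyed costs an element of X. *)
Lemma connect_common_nbrs X x y :
  adj x y -> #|X| <= #|[set w | adj x w && adj y w]| -> connect (del_edges X) x y.
Proof.
move=> xy; apply: contraTT => nc; rewrite -ltnNge.
set N := [set w | _].
have yN : y \notin N by rewrite inE adj_irr andbF.
have xyX : [set x; y] \in X.
  by apply: contraNT nc => xyX; apply: connect1; rewrite /del_edges /= xy.
(* [f] picks a deleted edge on the path through [w]; the element [y] of [y |: N] stands for the edge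
   [xy] itself. Injectivity of [f] gives [#|N| < #|X|]. *)
pose f w := if [set x; w] \in X then [set x; w] else [set y; w].
have neq (u w : G) : adj u w -> (u == w) = false.
  by apply: contraTF => /eqP ->; rewrite adj_irr.
have fN w : w \in N -> [set x; w] \notin X -> [set y; w] \in X.
  rewrite inE => /andP[xw yw] xwX; apply: contraNT nc => ywX.
  apply: (connect_trans (connect1 (_ : del_edges X x w))); first by rewrite /del_edges /= xw.
  by rewrite connect_del_edges_sym; apply: connect1; rewrite /del_edges /= yw.
have fX : f @: (y |: N) \subset X.
  apply/subsetP => _ /imsetP[w wN ->]; rewrite /f; case: ifPn => // xwX.
  by case/setU1P: wN => [wy|/fN]; [rewrite wy xyX in xwX | apply].
apply: leq_trans (subset_leq_card fX); rewrite card_in_imset ?cardsU1 ?yN //.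
have xw w : w \in y |: N -> adj x w by case/setU1P=> [->|]; rewrite // inE => /andP[].
have inj (u w w' : G) : adj u w -> [set u; w] = [set u; w'] -> w = w'.
  move=> uw /setP/(_ w); rewrite !inE eqxx orbT => /esym/orP[/eqP wu|/eqP//].
  by move: uw; rewrite wu adj_irr.
have ne w w' : w' \in y |: N -> [set x; w] = [set y; w'] -> False.
  move=> /xw xw' /setP/(_ x); rewrite !inE eqxx (neq _ _ xy) (neq _ _ xw').
  by [].
move=> w w' wN w'N; rewrite /f; case: ifPn => wX; case: ifPn => w'X.
- by apply: inj; apply: xw.
- by move/(ne _ _ w'N).
- by move/esym/(ne _ _ wN).
- apply: inj; case/setU1P: wN => [wy|]; first by rewrite wy xyX in wX.
  by rewrite inE => /andP[].
Qed.

(** Inclusion-exclusion on the two neighbourhoods bounds the number of common neighbours from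
    below. *)
Lemma connect_deg_sum X x y :
  adj x y -> #|X| + #|G| <= gdeg x + gdeg y -> connect (del_edges X) x y.
Proof.
move=> xy le; apply: connect_common_nbrs => //.
have -> : [set w | adj x w && adj y w] = [set w | adj x w] :&: [set w | adj y w].
  by apply/setP => w; rewrite !inE.
have leU : #|[set w | adj x w] :|: [set w | adj y w]| <= #|G| by apply: max_card.
rewrite -(leq_add2r #|G|); apply: (leq_trans le).
by rewrite /gdeg -cardsUI addnC leq_add2l.
Qed.

Lemma connect_hub X v :
  (forall x, connect (del_edges X) x v) -> forall x y, connect (del_edges X) x y.
Proof. by move=> hub x y; apply: (connect_trans (hub x)); rewrite connect_del_edges_sym. Qed.
End Connectivity.

(** * Positive eigenvectors and the quadratic form *)

Section Perron.
Variable R : rcfType.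
Local Open Scope ring_scope.

Definition perron_value (G : sgraph) (t : R) : Prop :=
  exists2 x : G -> R, forall v, 0 < x v &
    forall v, \sum_w (adj v w)%:R * x w = t * x v.

(** Weighted AM-GM: for [z = x y] and adjacent [v], [w], [2 x_v x_w y_v y_w <= x_v x_w (y_v^2 +
    y_w^2)]; by the eigenvector equation the right sides sum to [2 t |z|^2]. *)
Lemma perron_form_le (G : sgraph) (t : R) (z : G -> R) : perron_value G t ->
  \sum_v \sum_w (adj v w)%:R * (z v * z w) <= t * \sum_v z v ^+ 2.
Proof.
case=> x x0 xt; pose y v := z v / x v.
have zE v : z v = x v * y v by rewrite mulrC divfK // gt_eqF.
pose S := \sum_v \sum_w (adj v w)%:R * (x v * x w * y v ^+ 2).
have SE : S = t * \sum_v z v ^+ 2.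
  rewrite mulr_sumr; apply: eq_bigr => v _.
  transitivity (x v * y v ^+ 2 * \sum_w (adj v w)%:R * x w).
    by rewrite mulr_sumr; apply: eq_bigr => w _; ring.
  by rewrite xt zE; ring.
have SE' : S = \sum_v \sum_w (adj v w)%:R * (x v * x w * y w ^+ 2).
  rewrite /S exchange_big; apply: eq_bigr => v _; apply: eq_bigr => w _.
  by rewrite adj_sym; ring.
rewrite -SE -(ler_pM2l (ltr0n R 2)) (_ : 2 * S = S + S); last by ring.
rewrite {2}SE'.
rewrite -big_split mulr_sumr; apply: ler_sum => v _.
rewrite -big_split mulr_sumr; apply: ler_sum => w _ /=.
rewrite !zE; case: adj; last by rewrite !mul0r mulr0 addr0.
rewrite !mul1r -subr_ge0; have : 0 <= x v * x w * (y v - y w) ^+ 2.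
  by rewrite mulr_ge0 ?sqr_ge0 // ltW // mulr_gt0.
by congr (_ <= _); ring.
Qed.

Lemma natr_gdeg (G : sgraph) (v : G) : (gdeg v)%:R = \sum_w (adj v w)%:R :> R.
Proof. by rewrite gdegE natr_sum. Qed.

(** The partition is equitable, so a vector constant on both parts suffices. The quadratic
    hypothesis is the characteristic equation of the quotient matrix; [d1 < t] makes the entry on
    [G2] positive. *)
Lemma perron_join (G1 G2 : sgraph) (d1 d2 t : R) :
  (forall v : G1, (gdeg v)%:R = d1) -> (forall v : G2, (gdeg v)%:R = d2) ->
  (0 < #|G2|)%N -> d1 < t -> (t - d1) * (t - d2) = #|G1|%:R * #|G2|%:R ->
  perron_value (gjoin G1 G2) t.
Proof.
move=> reg1 reg2 G2_gt0 d1t tE.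
exists (fun v => if v is inl _ then #|G2|%:R else t - d1).
  by case=> v; rewrite ?ltr0n ?subr_gt0.
case=> v; rewrite big_sumType /= -!mulr_suml -?natr_gdeg ?reg1 ?reg2 sumr_const.
  by ring.
rewrite -tE; ring.
Qed.

(** The three equations say that [(a, b, c)] is an eigenvector of the quotient matrix of the
    equitable partition. *)
Lemma perron_join3 (G1 G2 G3 : sgraph) (d1 d2 d3 a b c t : R) :
  (forall v : G1, (gdeg v)%:R = d1) -> (forall v : G2, (gdeg v)%:R = d2) ->
  (forall v : G3, (gdeg v)%:R = d3) -> 0 < a -> 0 < b -> 0 < c ->
  d1 * a + #|G2|%:R * b = t * a ->
  #|G1|%:R * a + d2 * b + #|G3|%:R * c = t * b ->
  #|G2|%:R * b + d3 * c = t * c ->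
  perron_value (gjoin3 G1 G2 G3) t.
Proof.
move=> reg1 reg2 reg3 a0 b0 c0 Ea Eb Ec.
exists (fun v => match v with inl (inl _) => a | inl (inr _) => b | inr _ => c end).
  by case=> [[]|].
case=> [[v|v]|v]; rewrite !big_sumType /= -!mulr_suml -?natr_gdeg.
- by rewrite reg1 !sumr_const -Ea mul0rn mul0r addr0.
- by rewrite reg2 !sumr_const -Eb.
- by rewrite reg3 !sumr_const -Ec mul0rn mul0r add0r.
Qed.
End Perron.

(** * The graphs H(r, h) *)

Section Blocks.
Variable R : rcfType.

(** What the theorem uses of H(r,h); [block_odd] yields the parity condition on components when [f]
    is constant. *)
Record block (r h : nat) (t : R) (B : sgraph) : Prop := Block {
  block_max_degree : max_degree B = r;
  block_card : 1 < #|B|;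
  block_conn : edge_conn_ge B h;
  block_odd : ~~ odd r \/ odd h -> odd #|B|;
  block_perron : perron_value B t }.

Lemma block_even r h : 1 <= h -> h < r -> ~~ odd r || ~~ odd h ->
  block r h (rho R r h)
    (gjoin (gcompl (copies h./2 (Kgraph 2))) (Kgraph (r + 1 - 2 * h./2))).
Proof.
move=> h1 hr ev; set B := gjoin _ _.
have kh : 2 * h./2 <= h by rewrite mul2n -[leqRHS]odd_double_half leq_addl.
have c1 : #|gcompl (copies h./2 (Kgraph 2))| = 2 * h./2.
  by rewrite card_copies card_complete mulnC.
have c2 : #|Kgraph (r + 1 - 2 * h./2)| = r + 1 - 2 * h./2 by rewrite card_complete.
have cB : #|B| = r.+1 by rewrite card_join c1 c2; lia.
have d1 a : gdeg (inl a : B) + 1 = r.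
  by rewrite gdeg_join_l c2; have := gdeg_cocktail a; lia.
have d2 b : gdeg (inr b : B) = r.
  by rewrite gdeg_join_r c1; have := gdeg_complete b; lia.
have m0 : 0 < r + 1 - 2 * h./2 by lia.
pose v0 : B := inr (Ordinal m0 : Kgraph _).
have dv : gdeg v0 = r by apply: d2.
split.
- rewrite (@max_degree_eq B v0) ?dv // => -[a|b]; last by rewrite d2.
  by have := d1 a; lia.
- by rewrite cB; lia.
(* [v0] is adjacent to every other vertex, and the degree sum is at least [2r - 1 = #|B| + (r - 2)],
   where [r - 2 >= h - 1 >= #|X|]. *)
- move=> X Xh; apply: (connect_hub (v := v0)) => x.
  have [-> //|xv] := eqVneq x v0.
  apply: connect_deg_sum; last first.
    by rewrite cB dv; case: x {xv} => x; [have := d1 x | rewrite d2]; lia.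
  by case: x xv.
(* Here [r] must be even: an odd [r] would make [h] both even and odd. *)
- rewrite cB /= => oe; move: ev; case: (odd r) oe => //= -[] //.
  by move=> ->.
- rewrite /rho ev.
  set D := ((r%:R + 2) ^+ 2 - 8 * (h./2)%:R)%R.
  have kr : (2 * (h./2)%:R < r%:R :> R)%R by rewrite -natrM ltr_nat; lia.
  have k0 : (0 <= (h./2)%:R :> R)%R by apply: ler0n.
  have D0 : (0 < D)%R by rewrite /D; nra.
  set s := Num.sqrt D; have s0 : (0 < s)%R by rewrite sqrtr_gt0.
  have sE : (s ^+ 2 = D)%R by rewrite sqr_sqrtr // ltW.
  apply: (@perron_join _ _ _ (2 * (h./2)%:R - 2) (r%:R - 2 * (h./2)%:R)).
  + by move=> v; rewrite -natrM -(gdeg_cocktail v) natrD addrK.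
  + move=> v; apply/eqP; rewrite eq_sym subr_eq -natrM -natrD; apply/eqP; congr (_%:R)%R.
    by have := gdeg_complete v; lia.
  + by rewrite c2.
  (* Otherwise [s <= 4k - 2 - r] with [k = h./2]. This is negative for [k = 0], and squaring it
     gives [r + 1 <= 2k] for [k > 0], against [kr]. *)
  + rewrite ltNge; apply/negP => ts.
    have {}ts : (s <= 4 * (h./2)%:R - 2 - r%:R)%R by lra.
    move: sE; rewrite /D; nra.
  + rewrite c1 c2 natrB ?natrD ?natrM; last by lia.
    (* The two sides differ by [(s ^+ 2 - D) / 4], a zero inserted here to leave a polynomial
       identity in [s]. *)
    rewrite -[RHS]addr0 -[X in (_ = _ + X)%R](mul0r 4^-1%R) -(subrr D) -{1}sE /D.
    by field.
Qed.

Lemma block_odd3 r h : 2 < h -> h < r -> odd r -> odd h ->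
  block r h (rho R r h)
    (gjoin (gcompl (cycle_graph h)) (gcompl (copies (r + 2 - h)./2 (Kgraph 2)))).
Proof.
move=> h3 hr odr odh; set B := gjoin _ _.
have hr2 : h + 2 <= r by lia.
have mE : 2 * (r + 2 - h)./2 = r + 2 - h by lia.
have c1 : #|gcompl (cycle_graph h)| = h by apply: card_ord.
have c2 : #|gcompl (copies (r + 2 - h)./2 (Kgraph 2))| = r + 2 - h.
  by rewrite card_copies card_complete mulnC.
have cB : #|B| = r.+2 by rewrite card_join c1 c2; lia.
have e1 (a : gcompl (cycle_graph h)) : gdeg a + 3 = h.
  have := @gdeg_compl (cycle_graph h) a.
  by rewrite (gdeg_cycle (a : cycle_graph h) h3) c1; lia.
have d1 a : gdeg (inl a : B) + 1 = r.
  by rewrite gdeg_join_l c2; have := e1 a; lia.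
have d2 b : gdeg (inr b : B) = r.
  by rewrite gdeg_join_r c1; have := gdeg_cocktail b; lia.
have h0 : 0 < h by lia.
have m0 : 0 < (r + 2 - h)./2 by lia.
pose b0 : gcompl (copies (r + 2 - h)./2 (Kgraph 2)) := (Ordinal m0, ord0).
pose a0 : gcompl (cycle_graph h) := Ordinal h0.
split.
- rewrite (@max_degree_eq B (inr b0)) ?d2 // => -[a|b]; last by rewrite d2.
  by have := d1 a; lia.
- by rewrite cB; lia.
- move=> X Xh.
  (* Parity gives [h + 2 <= r], so across the join the degree sum [2r - 1] is at least
     [#|B| + h - 1]. Vertices of the second part are then linked through [a0]. *)
  have ab a b : connect (del_edges X) (inl a : B) (inr b).
    by apply: connect_deg_sum => //; rewrite cB d2; have := d1 a; lia.
  apply: (connect_hub (v := inr b0 : B)) => -[a|b]; first exact: ab.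
  by rewrite connect_del_edges_sym; apply: connect_trans (ab a0 b); rewrite connect_del_edges_sym.
- by rewrite cB /= odr.
- rewrite /rho odr odh /= ifN; last by lia.
  set D := ((r%:R + 3) ^+ 2 - 4 * h%:R)%R.
  have kr : (h%:R < r%:R :> R)%R by rewrite ltr_nat.
  have k0 : (0 < h%:R :> R)%R by rewrite ltr0n.
  have D0 : (0 < D)%R by rewrite /D; nra.
  set s := Num.sqrt D; have s0 : (0 < s)%R by rewrite sqrtr_gt0.
  have sE : (s ^+ 2 = D)%R by rewrite sqr_sqrtr // ltW.
  apply: (@perron_join _ _ _ (h%:R - 3) (r%:R - h%:R)).
  + by move=> v; rewrite -[in RHS](e1 v) natrD addrK.
  + move=> v; apply/eqP; rewrite eq_sym subr_eq -natrD; apply/eqP; congr (_%:R)%R.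
    by have := gdeg_cocktail v; lia.
  + by rewrite c2; lia.
  + rewrite ltNge; apply/negP => ts.
    have {}ts : (s <= 2 * h%:R - 3 - r%:R)%R by lra.
    move: sE; rewrite /D; nra.
  + rewrite c1 c2 natrB ?natrD; last by lia.
    rewrite -[RHS]addr0 -[X in (_ = _ + X)%R](mul0r 4^-1%R) -(subrr D) -{1}sE /D.
    by field.
Qed.

Section PathBlock.
Variable r : nat.
Hypotheses (r1 : 1 < r) (odr : odd r).
Local Notation G2 := (gcompl (copies (r - 1)./2 (Kgraph 2))).
Local Notation B := (gjoin3 (Kgraph 1) G2 (Kgraph 2)).

(** The cubic is [2 - 2r < 0] at 1 and positive at [r + 2], so its largest root exceeds 1; this
    makes the vector in [block_odd1] positive. *)
Lemma rho_odd1 (t := rho R r 1) :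
  (1 < t /\ t ^+ 3 - (r%:R - 2) * t ^+ 2 - 2 * r%:R * t + (r%:R - 1) = 0)%R.
Proof.
rewrite {}/t /rho odr /=; set p := (_ + _)%R.
have r2 : (2 <= r%:R :> R)%R by rewrite ler_nat.
have pE x : (p.[x] = x ^+ 3 - (r%:R - 2) * x ^+ 2 - 2 * r%:R * x + (r%:R - 1))%R.
  by rewrite /p !hornerE.
have p0 : p != 0%R.
  by apply: contraTneq isT => p0; have := pE 1%R; rewrite p0 horner0; lra.
have [x x1 px] : exists2 x : R, (1 < x)%R & root p x.
  have [| |x] := @poly_ivt _ p 1%R (r%:R + 2)%R; first by lra.
    by rewrite !pE; apply/andP; split; nra.
  move=> /andP[x1 _] px; exists x => //; rewrite lt_neqAle x1 andbT.
  by apply: contraTneq px => <-; rewrite rootE pE; lra.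
have xr : x \in roots_desc p.
  by rewrite -has_pred1 has_count count_roots_desc // -XsubC_dvd // dvdp_XsubCl.
have sz : 0 < size (roots_desc p) by case: (roots_desc p) xr.
have t_in : ((roots_desc p)`_0)%R \in roots_desc p by apply: mem_nth.
split; last first.
  rewrite -pE; apply/eqP; rewrite -[_ == _]/(root p _).
  by move: t_in; rewrite -has_pred1 has_count count_roots_desc // -XsubC_dvd // dvdp_XsubCl.
apply: (lt_le_trans x1); case/(nthP 0%R): xr => i isz <-.
apply: (sorted_leq_nth ge_trans (@lexx _ R) 0%R (roots_desc_sorted p)); rewrite ?inE //.
Qed.

Lemma block_odd1 : block r 1 (rho R r 1) B.
Proof.
have c2 : #|G2| = r - 1 by rewrite card_copies card_complete; lia.
have cB : #|B| = r.+2 by rewrite !card_sum !card_ord c2; lia.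
have m0 : 0 < (r - 1)./2 by lia.
pose b0 : G2 := (Ordinal m0, ord0).
have d0 a : gdeg (inl (inl a) : B) = r - 1.
  by rewrite gdeg_join3_l c2; have := gdeg_complete a; lia.
have d1 b : gdeg (inl (inr b) : B) = r.
  by rewrite gdeg_join3_m !card_complete; have := gdeg_cocktail b; lia.
have d2 c : gdeg (inr c : B) = r.
  by rewrite gdeg_join3_r c2; have := gdeg_complete c; lia.
split.
- rewrite (@max_degree_eq B (inl (inr b0))) ?d1 // => -[[a|b]|c].
  + by rewrite d0 leq_subr.
  + by rewrite d1.
  + by rewrite d2.
- by rewrite cB.
- move=> X; rewrite ltnS leqn0 cards_eq0 => /eqP ->.
  have cadj (x y : B) : adj x y -> connect (del_edges set0) x y.
    by move=> xy; apply: connect1; apply/andP; rewrite inE.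
  pose a0 : B := inl (inl ord0).
  apply: (connect_hub (v := a0)) => -[[a|b]|c].
  + by rewrite (ord1 a).
  + exact: cadj.
  + by apply: (@connect_trans _ _ (inl (inr b0))); apply: cadj.
- by rewrite cB /= odr.
- have [t1] := rho_odd1; move: (rho R r 1) t1 => t t1 tE.
  have r1E : (#|G2|%:R = r%:R - 1 :> R)%R by rewrite c2 natrB // ltnW.
  have r10 : (0 < r%:R - 1 :> R)%R by rewrite -r1E ltr0n c2; lia.
  (* These entries solve the first and third quotient equations for every [t]; the middle one then
     becomes the cubic. *)
  apply: (@perron_join3 _ _ _ _ 0 (r%:R - 3) 1
           ((r%:R - 1) * (t - 1)) (t * (t - 1)) ((r%:R - 1) * t)).
  + by move=> v; have := gdeg_complete v; rewrite addn1 => -[->].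
  + move=> v; apply/eqP; rewrite eq_sym subr_eq -natrD; apply/eqP; congr (_%:R)%R.
    by have := gdeg_cocktail v; lia.
  + by move=> v; have := gdeg_complete v; rewrite addn1 => -[->].
  + by apply: mulr_gt0 => //; lra.
  + by apply: mulr_gt0; lra.
  + by apply: mulr_gt0 => //; lra.
  + by rewrite r1E; ring.
  + by rewrite !card_complete -[RHS]subr0 -[X in (_ = _ - X)%R]tE; ring.
  + by rewrite r1E; ring.
Qed.
End PathBlock.

Lemma Hgraph_block r h : 1 <= h -> h < r -> block r h (rho R r h) (Hgraph r h).
Proof.
move=> h1 hr; rewrite /Hgraph; case: ifPn => [ev|]; first exact: block_even.
rewrite negb_or !negbK => /andP[odr odh]; case: eqP => [h_1|h_n1].
  by rewrite h_1; apply: block_odd1; rewrite // h_1 in hr.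
by apply: block_odd3 => //; move: h1 odh h_n1; case: h {hr} => [|[|[|]]].
Qed.
End Blocks.

(** * The family *)

(** Handshake: ordering by [enum_rank] splits the related pairs into two equal halves. *)
Lemma sum_sym_irr_even (T : finType) (e : rel T) :
  symmetric e -> irreflexive e -> ~~ odd (\sum_x \sum_y e x y).
Proof.
move=> es ei; pose lt (x y : T) := enum_rank x < enum_rank y.
have -> : \sum_x \sum_y e x y = (\sum_x \sum_y (e x y && lt x y)).*2.
  rewrite -addnn [X in _ = _ + X]exchange_big -big_split; apply: eq_bigr => x _.
  rewrite -big_split; apply: eq_bigr => y _ /=; rewrite (es y x) /lt.
  have [->|xy] := eqVneq x y; first by rewrite ei.
  have : (enum_rank x : nat) <> enum_rank y.
    by move=> exy; move: xy; rewrite (enum_rank_inj (val_inj exy)) eqxx.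
  by case: (e x y) => //=; case: ltngtP.
by rewrite odd_double.
Qed.

Section QuadraticForm.
Variables (R : rcfType) (G : sgraph).
Local Open Scope ring_scope.

Lemma adj_mx_sym : (adj_mx R G)^T = adj_mx R G.
Proof. by apply/matrixP => i j; rewrite !mxE adj_sym. Qed.

Lemma adj_mx_form (z : 'rV[R]_#|G|) :
  (z *m adj_mx R G *m z^T) 0 0 =
  \sum_x \sum_y (adj x y)%:R * (z 0 (enum_rank x) * z 0 (enum_rank y)).
Proof.
rewrite mxE (reindex (@enum_rank G)) /=; last exact/onW_bij/enum_rank_bij.
rewrite exchange_big; apply: eq_bigr => y _.
rewrite !mxE (reindex (@enum_rank G)) /=; last exact/onW_bij/enum_rank_bij.
by rewrite mulr_suml; apply: eq_bigr => x _; rewrite !mxE !enum_rankK; ring.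
Qed.

Lemma row_dot (z : 'rV[R]_#|G|) :
  (z *m z^T) 0 0 = \sum_x z 0 (enum_rank x) ^+ 2.
Proof.
rewrite mxE (reindex (@enum_rank G)) /=; last exact/onW_bij/enum_rank_bij.
by apply: eq_bigr => x _; rewrite mxE.
Qed.
End QuadraticForm.

Section Family.
Variables (h l : nat) (B F : sgraph) (f : 'I_l -> 'I_h -> B).

(** The spliced graph in plain coordinates, without the subset types of [splice]: [inl] for U(F),
    [inr (u, v)] for the vertex [v] of copy [u]. *)
Definition spliced_adj : rel ('I_h + 'I_l * B) := fun x y =>
  match x, y with
  | inl _, inl _ => false
  | inl w, inr (u, v) | inr (u, v), inl w => f u w == v
  | inr (u, v), inr (u', v') => (u == u') && adj v v'
  end.

Variable psi : 'I_h + 'I_l * B -> F.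
Hypothesis psi_bij : bijective psi.
Hypothesis psi_adj : forall x y, adj (psi x) (psi y) = spliced_adj x y.

Let kept w := psi (inl w).
Let cp u v := psi (inr (u, v)).
Let U := [set kept w | w : 'I_h].

Let psi_inj : injective psi := bij_inj psi_bij.

Lemma kept_cp w u v : (kept w == cp u v) = false.
Proof. by rewrite /kept /cp (inj_eq psi_inj). Qed.

Lemma cp_inj u : injective (cp u).
Proof. by move=> v v' /psi_inj [->]. Qed.

Lemma kept_inj : injective kept.
Proof. by move=> w w' /psi_inj [->]. Qed.

Lemma psi_ind (P : F -> Prop) :
  (forall w, P (kept w)) -> (forall u v, P (cp u v)) -> forall x, P x.
Proof.
case: psi_bij => g _ gK Pk Pc x; rewrite -(gK x).
by case: (g x) => [w|[u v]]; [apply: Pk | apply: Pc].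
Qed.

Lemma cp_notin_U u v : cp u v \notin U.
Proof. by apply/imsetP => -[w _ /eqP]; rewrite eq_sym kept_cp. Qed.

Lemma big_psi (T : Type) (idx : T) (op : Monoid.com_law idx) (E : F -> T) :
  \big[op/idx]_x E x =
  op (\big[op/idx]_w E (kept w)) (\big[op/idx]_u \big[op/idx]_v E (cp u v)).
Proof.
rewrite (reindex psi) /=; last exact: onW_bij.
by rewrite big_sumType pair_bigA /=; congr (op _ _); apply: eq_bigr => -[].
Qed.

Lemma gdeg_kept w : gdeg (kept w) = l.
Proof.
rewrite gdegE big_psi /= big1 ?add0n => [|w' _]; last by rewrite psi_adj.
rewrite -[RHS]card_ord -sum1_card; apply: eq_bigr => u _.
rewrite (bigD1 (f u w)) //= psi_adj /= eqxx big1 // => v /negPf vf.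
by rewrite psi_adj /= eq_sym vf.
Qed.

Lemma cut_edge_inj (e : {set F}) u v u' v' w w' :
  e = [set cp u v; kept w] -> e = [set cp u' v'; kept w'] -> u = u' /\ w = w'.
Proof.
move=> -> /setP E; split.
  have /esym := E (cp u v); rewrite !inE eqxx /= [_ == kept _]eq_sym kept_cp orbF.
  by move/eqP/psi_inj => -[->].
have /esym := E (kept w); rewrite !inE eqxx orbT kept_cp /=.
by move/eqP/kept_inj.
Qed.

(** * Edge-connectivity of F and components of F - U(F) *)

Section EdgeConnectivity.
Hypotheses (h_gt0 : 0 < h) (hl : h < l) (B_conn : edge_conn_ge B h).

Let cut_edge u w := [set cp u (f u w); kept w].

Lemma adj_cut u w : adj (cp u (f u w)) (kept w).
Proof. by rewrite psi_adj /= eqxx. Qed.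

Lemma family_connect (X : {set {set F}}) : #|X| < h ->
  forall x y, connect (del_edges X) x y.
Proof.
move=> Xh.
have in_copy u v v' : connect (del_edges X) (cp u v) (cp u v').
  (* The trace of [X] on copy [u] is no larger than [X], as [cp u] is injective. *)
  pose Xu := [set e : {set B} | cp u @: e \in X].
  have XuX : #|Xu| < h.
    apply: leq_ltn_trans Xh; rewrite -(card_imset _ (imset_inj (@cp_inj u))).
    by apply/subset_leq_card/subsetP => _ /imsetP[e + ->]; rewrite inE.
  have /connectP[p pth ->] := B_conn XuX v v'.
  elim: p v pth => //= y p IHp v /andP[/andP[vy vyX] pth].
  apply: connect_trans (IHp _ pth); apply: connect1; apply/andP.
  rewrite psi_adj /= eqxx vy; split=> //.
  by move: vyX; rewrite inE imsetU1 imset_set1.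
have out u : exists w, connect (del_edges X) (cp u (f u w)) (kept w).
  (* Copy [u] has [h] distinct cut edges, more than [X] can contain. *)
  have [w wX] : exists w, cut_edge u w \notin X.
    apply/existsP; apply: contraTT Xh => /existsPn XE; rewrite -leqNgt.
    rewrite -[leqLHS]card_ord -cardsT -(card_imset _ (_ : injective (cut_edge u))).
      by apply/subset_leq_card/subsetP => _ /imsetP[w _ ->]; have := XE w; rewrite negbK.
    by move=> w w' E; have [] := cut_edge_inj erefl E.
  by exists w; apply: connect1; apply/andP; rewrite adj_cut.
(* If every copy lost a cut edge, [X] would contain [l > h] distinct edges. *)
have [u0 u0X] : exists u, forall w, cut_edge u w \notin X.
  suff /existsP[u /forallP uX] : [exists u, forall w, cut_edge u w \notin X] by exists u.
  apply: contraTT Xh => /existsPn XE; rewrite -leqNgt (leq_trans (ltnW hl)) //.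
  have {}XE u : {w | cut_edge u w \in X}.
    by apply/sigW; have /forallPn[w] := XE u; rewrite negbK; exists w.
  pose g u := cut_edge u (sval (XE u)).
  rewrite -[leqLHS]card_ord -cardsT -(card_imset _ (_ : injective g)).
    by apply/subset_leq_card/subsetP => _ /imsetP[u _ ->]; rewrite /g; case: (XE u).
  by move=> u u' E; have [] := cut_edge_inj erefl E.
have hub w : connect (del_edges X) (cp u0 (f u0 w)) (kept w).
  by apply: connect1; apply/andP; split; [apply: adj_cut | apply: u0X].
pose w0 := Ordinal h_gt0; pose v0 := cp u0 (f u0 w0).
have kv w : connect (del_edges X) (kept w) v0.
  rewrite connect_del_edges_sym; apply: connect_trans (hub w); exact: in_copy.
apply: (connect_hub (v := v0)); apply: psi_ind => // u v.
have [w uw] := out u; apply: connect_trans (kv w); apply: connect_trans uw.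
exact: in_copy.
Qed.

Lemma family_edge_connectivity : edge_connectivity F = h.
Proof.
have dis (X : {set {set F}}) : disconnecting X -> h <= #|X|.
  case/andP=> _ /existsP[x /existsP[y]]; apply: contraNT; rewrite -ltnNge => Xh.
  exact: family_connect.
pose u0 : 'I_l := Ordinal (leq_trans h_gt0 (ltnW hl)).
pose X := [set cut_edge u0 w | w : 'I_h].
have Xle : #|X| <= h by rewrite -[leqRHS]card_ord; apply: leq_imset_card.
have Xed : X \subset edges F.
  apply/subsetP => _ /imsetP[w _ ->].
  by apply/imsetP; exists (cp u0 (f u0 w), kept w); rewrite // inE adj_cut.
have Xdis : disconnecting X.
  rewrite /disconnecting Xed /=; pose w0 := Ordinal h_gt0.
  apply/existsP; exists (cp u0 (f u0 w0)); apply/existsP; exists (kept w0).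
  pose a := [pred x | [exists v, x == cp u0 v]].
  have clo : closed (del_edges X) a.
    apply: intro_closed; first exact: connect_del_edges_sym.
    move=> x y /andP[xy xyX] /existsP[v /eqP xE]; rewrite {x}xE in xy xyX *.
    move: y xy xyX; apply: psi_ind => [w|u v'].
      rewrite psi_adj /= => /eqP <- /negP[].
      by apply/imsetP; exists w.
    rewrite psi_adj /= => /andP[/eqP <- _] _; apply/existsP; exists v'; exact: eqxx.
  apply/negP => /(closed_connect clo); rewrite !inE.
  have -> : [exists v, cp u0 (f u0 w0) == cp u0 v] by apply/existsP; exists (f u0 w0).
  by move/esym/existsP=> -[v]; rewrite kept_cp.
have Xh : #|X| = h by apply/eqP; rewrite eqn_leq Xle dis.
(* The default [#|edges F|] is at least [h] because [X] consists of [h] edges. *)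
apply: bigminn_eq => [|Y /dis //|]; last by exists X.
by rewrite -[leqLHS]Xh subset_leq_card.
Qed.

(** A copy is connected, by [B_conn] with nothing deleted, and every edge leaving it ends in [U]. *)
Lemma copy_component u : [set cp u v | v : B] \in components_del U.
Proof.
pose v0 := f u (Ordinal h_gt0).
apply/imsetP; exists (cp u v0); first by rewrite inE cp_notin_U.
apply/setP; apply: psi_ind => [w|u' v'].
  rewrite !inE imset_f //=; apply/imsetP => -[v _ /eqP].
  by rewrite kept_cp.
rewrite inE inE cp_notin_U /=; apply/imsetP/idP => [[v _ E]|].
  have [-> ->] : u' = u /\ v' = v by move/psi_inj: E => [-> ->].
  have /connectP[p pth ->] : connect (del_edges (set0 : {set {set B}})) v0 v.
    by apply: B_conn; rewrite cards0.
  elim: p {E v'} (v0) pth => //= y p IHp x /andP[/andP[xy _] pth].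
  apply: connect_trans (IHp _ pth); apply: connect1.
  by rewrite /del_verts /= !cp_notin_U psi_adj /= eqxx.
pose a := [pred x | [exists v, x == cp u v]].
have clo : closed (del_verts U) a.
  apply: intro_closed.
    by apply: sym_connect_sym => x y; rewrite /del_verts /= andbCA adj_sym.
  move=> x y /and3P[_ yU xy] /existsP[v /eqP xE]; rewrite {x}xE in xy *.
  move: y yU xy; apply: psi_ind => [w|u1 v1]; first by rewrite imset_f.
  by rewrite psi_adj /= => _ /andP[/eqP <- _]; apply/existsP; exists v1.
move/(closed_connect clo); rewrite !inE.
have -> : [exists v, cp u v0 == cp u v] by apply/existsP; exists v0.
by move/esym/existsP=> -[v /eqP ->]; exists v.
Qed.
End EdgeConnectivity.

(** * Parity factors of F *)

Section ParityFactor.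
Variables (g k : F -> int) (b : int).
Hypothesis kU : forall w, k (kept w) = b.
Hypothesis k_odd : forall u, ((\sum_v k (cp u v))%R = 1 %[mod 2])%Z.

Lemma family_no_parity_factor : (b *+ h < l)%R -> ~ has_parity_factor g k.
Proof.
move=> bl [H [Hs HF Hd]].
have degE x : #|[set y | H x y]| = \sum_y H x y.
  by rewrite -sum1_card big_mkcond; apply: eq_bigr => y _; rewrite inE; case: (H x y).
(* [N u] counts the edges of [H] between copy [u] and U(F). *)
pose N u := \sum_v \sum_w H (cp u v) (kept w).
have dcp u v : \sum_y H (cp u v) y =
    \sum_w H (cp u v) (kept w) + \sum_v' H (cp u v) (cp u v').
  rewrite big_psi (bigD1 u) //= [X in _ + (_ + X)]big1 ?addn0 // => u' u'u.
  rewrite big1 // => v' _; apply/eqP; rewrite eqb0; apply/negP => /HF.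
  by rewrite psi_adj /= eq_sym (negPf u'u).
(* Modulo 2 the degrees in the copy add up to the sum of [k], which is odd, while inner edges count
   twice. *)
have Nodd u : odd (N u).
  have ev : ~~ odd (\sum_v \sum_v' H (cp u v) (cp u v')).
    apply: (@sum_sym_irr_even _ (fun v v' => H (cp u v) (cp u v'))) => [v v'|v].
      exact: Hs.
    by apply/negP => /HF; rewrite adj_irr.
  have : odd (\sum_v \sum_y H (cp u v) y).
    have modS : ((\sum_v k (cp u v))%R = Posz (\sum_v \sum_y H (cp u v) y) %[mod 2])%Z.
      rewrite (big_morph Posz PoszD (erefl (Posz 0))).
      apply: (big_ind2 (fun x y : int => (x = y %[mod 2])%Z)) => // [x1 x2 y1 y2 Ex Ey|v _].
        by rewrite -modzDm Ex Ey modzDm.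
      by have [_] := Hd (cp u v); rewrite degE.
    by move: modS; rewrite k_odd !modz_nat !modn2; case: (odd (\sum_v _)).
  rewrite (eq_bigr _ (fun v _ => dcp u v)) big_split /= oddD (negPf ev) addbF.
  by [].
have lN : l <= \sum_u N u.
  rewrite -[leqLHS]card_ord -sum1_card leq_sum // => u _.
  by case: (N u) (Nodd u).
(* Double counting: U(F) is independent, so these are all the edges of [H] at U(F). *)
have NE : \sum_u N u = \sum_w \sum_y H (kept w) y.
  rewrite /N; under eq_bigr do rewrite exchange_big /=.
  rewrite exchange_big /=; apply: eq_bigr => w _.
  rewrite big_psi /= [X in X + _]big1 ?add0n => [|w' _]; last first.
    by apply/eqP; rewrite eqb0; apply/negP => /HF; rewrite psi_adj.
  by apply: eq_bigr => u _; apply: eq_bigr => v _; rewrite Hs.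
have : (Posz (\sum_w \sum_y H (kept w) y) <= b *+ h)%R.
  rewrite (big_morph Posz PoszD (erefl (Posz 0))) -[X in (_ <= _ *+ X)%R]card_ord.
  rewrite -sumr_const; apply: ler_sum => w _.
  by have [/andP[_]] := Hd (kept w); rewrite degE kU.
by rewrite -NE; move: bl lN; lia.
Qed.
End ParityFactor.

(** * Eigenvalues of F *)

Section Spectrum.
Variables (R : rcfType) (t : R).
Hypotheses (B_perron : perron_value B t) (B_gt0 : 0 < #|B|).
Local Open Scope ring_scope.

Lemma card_family : #|F| = (h + l * #|B|)%N.
Proof. by rewrite -(bij_eq_card psi_bij) card_sum card_prod !card_ord. Qed.

(** Away from U(F) only the pairwise nonadjacent copies remain, so the form is a direct sum over
    them. *)
Lemma family_form (z : 'rV[R]_#|F|) :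
  (forall w, z 0 (enum_rank (kept w)) = 0) ->
  (z *m adj_mx R F *m z^T) 0 0 =
  \sum_u \sum_v \sum_v' (adj v v')%:R *
    (z 0 (enum_rank (cp u v)) * z 0 (enum_rank (cp u v'))).
Proof.
move=> z0; rewrite adj_mx_form big_psi /= big1 ?add0r => [|w _]; last first.
  by rewrite big1 // => y _; rewrite z0 mul0r mulr0.
apply: eq_bigr => u _; apply: eq_bigr => v _.
rewrite big_psi /= big1 ?add0r => [|w _]; last by rewrite z0 !mulr0.
rewrite (bigD1 u) //= [X in _ + X]big1 ?addr0 => [|u' u'u].
  by apply: eq_bigr => v' _; rewrite psi_adj /= eqxx.
by rewrite big1 // => v' _; rewrite psi_adj /= eq_sym (negPf u'u) mul0r.
Qed.

Lemma family_dot (z : 'rV[R]_#|F|) :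
  (forall w, z 0 (enum_rank (kept w)) = 0) ->
  (z *m z^T) 0 0 = \sum_u \sum_v z 0 (enum_rank (cp u v)) ^+ 2.
Proof.
by move=> z0; rewrite row_dot big_psi /= big1 ?add0r // => w _; rewrite z0 expr0n.
Qed.

Lemma family_eigenvalue_ge i : (i < l)%N -> t <= (roots_desc (char_poly (adj_mx R F)))`_i.
Proof.
case: psi_bij => q psiK qK; case: B_perron => x x0 xt.
(* Row [u] is the positive eigenvector [x] placed on copy [u]. *)
pose V : 'M[R]_(l, #|F|) := \matrix_(u, i)
  if q (enum_val i) is inr (u', v) then (u == u')%:R * x v else 0.
have VE (c : 'rV_(_)) u v : (c *m V) 0 (enum_rank (cp u v)) = c 0 u * x v.
  rewrite mxE (bigD1 u) //= mxE enum_rankK psiK eqxx mul1r.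
  by rewrite big1 ?addr0 // => u' u'u; rewrite mxE enum_rankK psiK (negPf u'u) mul0r mulr0.
have V0 (c : 'rV_(_)) w : (c *m V) 0 (enum_rank (kept w)) = 0.
  by rewrite mxE big1 // => u _; rewrite mxE enum_rankK psiK mulr0.
have Vf : row_free V.
  rewrite -kermx_eq0; apply/rowV0P => c /sub_kermxP cV.
  apply/rowP => u; have /card_gt0P[v _] := B_gt0.
  have /esym/eqP := VE c u v; rewrite cV !mxE mulf_eq0 => /orP[/eqP->//|].
  by rewrite gt_eqF.
apply: (eigenvalue_ge (adj_mx_sym R F) Vf) => c.
rewrite family_form // family_dot // mulr_sumr ler_sum // => u _.
rewrite mulr_sumr ler_sum // => v _.
rewrite VE; under eq_bigr do rewrite VE.
rewrite (eq_bigr (fun v' => c 0 u ^+ 2 * x v * ((adj v v')%:R * x v'))); last by move=> v' _; ring.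
by rewrite -mulr_sumr xt le_eqVlt; apply/orP; left; apply/eqP; ring.
Qed.

Lemma family_eigenvalue_le i : (h <= i < #|F|)%N -> (roots_desc (char_poly (adj_mx R F)))`_i <= t.
Proof.
move=> hi; case: psi_bij => q psiK qK.
(* The rows are the [#|F| - h] unit vectors at the vertices outside U(F). *)
pose V : 'M[R]_(#|{: 'I_l * B}|, #|F|) := \matrix_(p, i)
  (q (enum_val i) == inr (enum_val p))%:R.
have VE (c : 'rV_(_)) u v : (c *m V) 0 (enum_rank (cp u v)) = c 0 (enum_rank (u, v)).
  rewrite mxE (bigD1 (enum_rank (u, v))) //= mxE !enum_rankK psiK eqxx mulr1.
  rewrite big1 ?addr0 // => p pu; rewrite mxE enum_rankK psiK.
  case: eqP => [[E]|]; last by rewrite mulr0.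
  by move: pu; rewrite E enum_valK eqxx.
have V0 (c : 'rV_(_)) w : (c *m V) 0 (enum_rank (kept w)) = 0.
  by rewrite mxE big1 // => u _; rewrite mxE enum_rankK psiK mulr0.
have Vf : row_free V.
  rewrite -kermx_eq0; apply/rowV0P => c /sub_kermxP cV.
  apply/rowP => p; rewrite -(enum_valK p); case: (enum_val p) => u v.
  by rewrite -VE cV !mxE.
apply: (eigenvalue_le (adj_mx_sym R F) Vf) => [c|].
  rewrite family_form // family_dot // mulr_sumr ler_sum // => u _.
  exact: perron_form_le.
by rewrite card_prod card_ord card_family addnK -card_family.
Qed.
End Spectrum.
End Family.

(** * Coordinates on a member of the family, and assembly of the four claims *)

Lemma gdeg_iso (G G' : sgraph) (iso : G -> G') (v : G) : bijective iso ->
  (forall x y, adj (iso x) (iso y) = adj x y) -> gdeg (iso v) = gdeg v.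
Proof.
move=> bi ai; rewrite !gdegE (reindex iso); last exact: onW_bij.
by apply: eq_bigr => w _; rewrite ai.
Qed.

(* psi lists U(F) and then the l copies of H(r,h); f u w is the vertex of the
   u-th copy to which the w-th vertex of U(F) is attached. *)
Lemma in_family_psi r h l (F : sgraph) (U : {set F}) :
  max_degree (Hgraph r h) = r -> in_family r h l U ->
  exists (f : 'I_l -> 'I_h -> Hgraph r h) (psi : 'I_h + 'I_l * Hgraph r h -> F),
  [/\ bijective psi, forall x y, adj (psi x) (psi y) = spliced_adj f x y,
      U = [set psi (inl w) | w : 'I_h] &
      forall u, exists v0, [\/ gdeg (psi (inr (u, v0))) = r |
                               gdeg (psi (inr (u, v0))) = r + 1] /\
        forall v, v != v0 -> gdeg (psi (inr (u, v))) = r].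
Proof.
move=> maxB [phi [vs [iso [bi ai UE]]]].
have nL (w : 'I_h) : (@inl 'I_h 'I_l w : complete_bip h l) \notin bip_right h l by rewrite inE.
have nR (u : 'I_l) : (@inr 'I_h 'I_l u : complete_bip h l) \in bip_right h l by rewrite inE.
pose L w : {x : complete_bip h l | x \notin bip_right h l} :=
  exist _ (@inl 'I_h 'I_l w) (nL w).
pose Rt u : {x : complete_bip h l | x \in bip_right h l} :=
  exist _ (@inr 'I_h 'I_l u) (nR u).
pose K := splice (bip_right h l) phi.
pose th (x : 'I_h + 'I_l * Hgraph r h) : K :=
  match x with
  | inl w => @inl _ ({x | x \in bip_right h l} * Hgraph r h) (L w)
  | inr (u, v) => @inr {x | x \notin bip_right h l} _ (Rt u, v)
  end.
(* Branches contradicting membership in the subset types carry arbitrary values;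
   [phi (val y) (val y)] merely supplies a vertex of the block. *)
pose th' (x : K) : 'I_h + 'I_l * Hgraph r h :=
  match x with
  | inl y => match val y with inl w => inl w | inr u => inr (u, phi (val y) (val y)) end
  | inr (y, v) => match val y with inl w => inl w | inr u => inr (u, v) end end.
have thK : cancel th th' by case=> [w|[u v]].
have th'K : cancel th' th.
  move=> [[[w|u] p]|[[[w|u] p] v]] /=.
  - by congr inl; apply: val_inj.
  - by exfalso; move: p; rewrite inE.
  - by exfalso; move: p; rewrite inE.
  - by congr (inr (_, _)); apply: val_inj.
have bth : bijective th by exists th'.
exists (fun u w => phi (@inr 'I_h 'I_l u) (@inl 'I_h 'I_l w)), (iso \o th); split.
- exact: bij_comp.
(* The spliced vertices are pairwise nonadjacent in K_{h,l}, so no edge joins two different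
   copies. *)
- move=> x y; rewrite /= ai; case: x y => [w|[u v]] [w'|[u' v']] //=.
  by rewrite orbF -(inj_eq val_inj).
- rewrite UE; apply/setP => x; apply/imsetP/imsetP => [[y yk ->]|[w _ ->]].
    have := th'K y; case: (th' y) => [w|[u v]] E; first by exists w; rewrite // -E.
    by move: yk; rewrite -E inE.
  by exists (th (inl w)); rewrite // inE.
- move=> u; have [_ [v0 []]] := vs (Rt u).
  rewrite /= maxB => d0 d1; exists v0.
  have gE v : gdeg ((iso \o th) (inr (u, v))) = gdeg (th (inr (u, v))) by apply: gdeg_iso.
  by split=> [|v vv0]; rewrite !gE //; apply: d1.
Qed.

Theorem theorem5p4 (R : rcfType) (r h l : nat) (F : sgraph) (U : {set F})
    (h_ge1 : 1 <= h) (h_lt_r : h < r) (r_le_l : r <= l)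
    (F_in : in_family r h l U) :
  [/\ min_degree F = r,
      edge_connectivity F = h,
      (forall i : nat, h + 1 <= i <= l -> lambda R F i = rho R r h) &
      forall b : int, largest_odd_below (l%:R / h%:R)%R b ->
        (forall g f : F -> int,
            (forall v : F, (g v <= f v)%R) ->
            (forall v : F, (g v = f v %[mod 2])%Z) ->
            (forall w : F, w \in U -> f w = b) ->
            (forall C : {set F}, C \in components_del U ->
               ((\sum_(v in C) f v)%R = 1 %[mod 2])%Z) ->
            ~ has_parity_factor g f) /\
        (~~ odd r \/ odd h -> ~ has_odd_factor F 1 b)].
Proof.
have [B_deg B_card B_conn B_odd B_perron] := Hgraph_block R h_ge1 h_lt_r.
have [phi [psi [bij_psi adj_psi UE degs]]] := in_family_psi B_deg F_in.
have hl : h < l := leq_trans h_lt_r r_le_l.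
have B_gt0 : 0 < #|Hgraph r h| := ltnW B_card.
have cF := card_family bij_psi.
have lF : l <= #|F| by rewrite cF (leq_trans (leq_pmulr _ B_gt0)) ?leq_addl.
split.
- apply: bigminn_eq; first exact: leq_trans lF.
    move=> x _; elim/(psi_ind bij_psi): x => [w|u v].
      by rewrite (gdeg_kept bij_psi adj_psi).
    have [v0 [d0 d1]] := degs u.
    have [->|/d1 ->//] := eqVneq v v0.
    by case: d0 => ->; rewrite ?leq_addr.
  pose u0 : 'I_l := Ordinal (leq_ltn_trans (leq0n h) hl).
  have [v0 [_ d1]] := degs u0.
  (* Only [v0] can have degree [r + 1], and one of two distinct vertices of the copy avoids it. *)
  have /card_gt1P[v [v' [_ _ vv']]] := B_card.
  have [vv0|/d1 vr] := eqVneq v v0; last by exists (psi (inr (u0, v))).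
  by exists (psi (inr (u0, v'))); rewrite ?d1 // -vv0 eq_sym.
- exact: (family_edge_connectivity bij_psi adj_psi).
(* [lambda] counts from 1, so the list index [i.-1] satisfies [h <= i.-1 < l]. *)
- move=> i /andP[hi il]; rewrite addn1 in hi; apply/eqP; rewrite eq_le; apply/andP; split.
    apply: (family_eigenvalue_le bij_psi adj_psi) => //; apply/andP; split; first by lia.
    by apply: leq_trans lF; lia.
  by apply: (family_eigenvalue_ge bij_psi adj_psi) => //; lia.
- move=> b [b_odd b_lt _].
  have bh : (b *+ h < l)%R.
    move: b_lt; rewrite ltr_pdivlMr ?ltr0n //.
    by rewrite -[X in (_ * X)%R]/((Posz h)%:~R)%R
      -[X in (_ < X)%R]/((Posz l)%:~R)%R -intrM ltr_int -[(b *+ h)%R]mulr_natr natz.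
  have sumC (k : F -> int) u : (\sum_(x in [set psi (inr (u, v)) | v : Hgraph r h]) k x =
      \sum_v k (psi (inr (u, v))))%R.
    by rewrite big_imset //= => v v' _ _ /(bij_inj bij_psi) [].
  have comp := copy_component bij_psi adj_psi h_ge1 B_conn.
  split=> [g k _ _ kU kC|oe].
    apply: (family_no_parity_factor bij_psi adj_psi (b := b)) => // [w|u].
      by apply: kU; rewrite UE imset_f.
    by rewrite -sumC; apply: kC; rewrite UE.
  apply: (family_no_parity_factor bij_psi adj_psi (b := b)) => // u.
  (* The sum over a copy is [b] times the order of the block, a product of odd numbers. *)
  rewrite sumr_const; have := B_odd oe; move: b_odd; rewrite /odd_int.
  move=> b1 B1; rewrite -[(b *+ _)%R]mulr_natr natz -modzMm b1 modzMm mul1r modz_nat modn2.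
  by rewrite B1.
Qed.
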